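(* Let $\{x^k\}$ be generated by the general AdaBB algorithm (see context) from some $x^0\in\mathbb{R}^n$, $\alpha_0>0$, $\theta_0\ge0$. Then $\{x^k\}$ converges to an optimal solution of $\min_{x\in\mathbb{R}^n}f(x)$. Moreover, $$\min_{1\le i\le k}\|\nabla f(x^i)\|^2=O\left(\frac1k\right).$$
   Context: $\|\cdot\|$ is the Euclidean norm and $B(x,r)$ the closed ball with center $x$ and radius $r$. $f:\mathbb{R}^n\to\mathbb{R}$ is convex and differentiable with locally Lipschitz gradient; its set of minimizers $\mathcal{X}^*$ is nonempty, $f_*=\min f$, and $x^*\in\mathcal{X}^*$ is fixed. General AdaBB algorithm. Input $x^0\in\mathbb{R}^n$, $\alpha_0>0$, $\theta_0\ge0$. Set $x^1=x^0-\alpha_0\nabla f(x^0)$. For $k=1,2,\dots$ let $$\lambda_k=\frac{\langle\nabla f(x^k)-\nabla f(x^{k-1}),x^k-x^{k-1}\rangle}{\|\nabla f(x^k)-\nabla f(x^{k-1})\|^2}.$$ (Case i) If $\lambda_k\ge\alpha_{k-1}$: $\alpha_k=\sqrt{1+\theta_{k-1}}\,\alpha_{k-1}$ and $\theta_k=\alpha_k/\alpha_{k-1}$. (Case ii) If $\alpha_{k-1}/2<\lambda_k<\alpha_{k-1}$: $\alpha_k=\min\left\{\sqrt{\frac{\lambda_k}{2(\alpha_{k-1}-\lambda_k)}},\sqrt{\frac{(1+\theta_{k-1})\lambda_k}{2\lambda_k-\alpha_{k-1}}}\right\}\alpha_{k-1}$ (Option I) or $\alpha_k=\lambda_k$ (Option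 II), and $\theta_k=\frac{2\alpha_k}{\alpha_{k-1}}-\frac{\alpha_k}{\lambda_k}$. (Case iii) If $\lambda_k\le\alpha_{k-1}/2$: $\alpha_k=\sqrt{\frac{\alpha_{k-1}}{2(\alpha_{k-1}-\lambda_k)}}\,\lambda_k$ (Option I) or $\alpha_k=\lambda_k/\sqrt2$ (Option II), and $\theta_k=\alpha_k/\alpha_{k-1}$. Then $x^{k+1}=x^k-\alpha_k\nabla f(x^k)$. In each of Cases ii and iii either option may be selected. It is assumed that $\nabla f(x^k)\ne\nabla f(x^{k-1})$ for all $k\ge1$, so that $\lambda_k$ is well defined. Define - $M_1=0$, $P_1=\frac{\alpha_1^2}{\alpha_0}$ if $\lambda_1\ge\alpha_0$; - $M_1=\frac{\alpha_1^2}{\lambda_1\alpha_0}-\frac{\alpha_1^2}{\alpha_0^2}$, $P_1=\frac{2\alpha_1^2}{\alpha_0}-\frac{\alpha_1^2}{\lambda_1}$ if $\frac{\alpha_0}2<\lambda_1<\alpha_0$; - $M_1=\frac{\alpha_1^2}{\lambda_1^2}-\frac{\alpha_1^2}{\alpha_0\lambda_1}$, $P_1=\frac{\alpha_1^2}{\alpha_0}$ if $0<\lambda_1\le\frac{\alpha_0}2$. Local smoothness: there is $L>0$ with $f(x)-f(y)-\langle\nabla f(y),x-y\rangle\ge\frac1{2L}\|\nabla f(x)-\nabla f(y)\|^2$ for all $x,y\in B(x^*,R)$, where $R^2=\|x^0-x^*\|^2+\alpha_0^2(1+2M_1)\|\nabla f(x^0)\|^2+\max\{2P_1-2\alpha_0,0\}(f(x^0)-f_*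 )$. $O(\cdot)$ is as $k\to\infty$, with constants independent of $k$. *)

(* Defs.v *)
From HB Require Import structures.
From mathcomp Require Export all_boot all_order all_algebra.
From mathcomp Require Export all_classical all_reals all_analysis.
Export numFieldNormedType.Exports.

Set Implicit Arguments.
Unset Strict Implicit.
Unset Printing Implicit Defensive.

Import Order.TTheory GRing.Theory Num.Theory.
Local Open Scope classical_set_scope.
Local Open Scope ring_scope.

Section euclidean.
Context {R : realType} {n : nat}.
Implicit Types (u v c : 'rV[R]_n) (f : 'rV[R]_n -> R).

Definition dotp u v : R := \sum_(i < n) u 0 i * v 0 i.

(* The library norm `|u| on 'rV[R]_n is the sup norm, hence the separate
   Euclidean norm and balls; both norms induce the same topology, so
   differentiability and convergence are the library's. *)
Definition enorm u : R := Num.sqrt (dotp u u).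

Definition eball c (r : R) : set 'rV[R]_n := [set u | enorm (u - c) <= r].

Definition grad f u : 'rV[R]_n := \row_(i < n) 'D_(delta_mx 0 i) f u.

Definition locally_lipschitz (F : 'rV[R]_n -> 'rV[R]_n) : Prop :=
  forall c, exists r K : R, 0 < r /\
    {in eball c r &, forall u v, enorm (F u - F v) <= K * enorm (u - v)}.

Definition minimizers f : set 'rV[R]_n := [set u | forall v, f u <= f v].

End euclidean.

Section adabb.
Context {R : realType}.

Definition adabb_lambda {n : nat} (f : 'rV[R]_n -> R) (x : nat -> 'rV[R]_n)
    (k : nat) : R :=
  let dg := grad f (x k) - grad f (x k.-1) in
  dotp dg (x k - x k.-1) / enorm dg ^+ 2.

(* One stepsize update (a, t) = (alpha_{k-1}, theta_{k-1}) ->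
   (a', t') = (alpha_k, theta_k), with l = lambda_k. The disjunctions are the
   choice between Options I and II, which is left free at every iteration. *)
Definition adabb_update (l a t a' t' : R) : Prop :=
  [/\ (* Case i *)
      a <= l ->
        a' = Num.sqrt (1 + t) * a /\ t' = a' / a,
      (* Case ii *)
      a / 2 < l < a ->
        (a' = Num.min (Num.sqrt (l / (2 * (a - l))))
                      (Num.sqrt ((1 + t) * l / (2 * l - a))) * a
         \/ a' = l) /\
        t' = 2 * a' / a - a' / l
    & (* Case iii *)
      l <= a / 2 ->
        (a' = Num.sqrt (a / (2 * (a - l))) * l
         \/ a' = l / Num.sqrt 2) /\
        t' = a' / a].

(* Runs of the algorithm. The last clause is the standing assumption that
   makes every lambda_k well defined. *)
Definition adabb {n : nat} (f : 'rV[R]_n -> R) (x : nat -> 'rV[R]_n)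
    (alpha theta : nat -> R) : Prop :=
  [/\ 0 < alpha 0%N,
      0 <= theta 0%N,
      forall k, x k.+1 = x k - alpha k *: grad f (x k),
      forall k, (1 <= k)%N ->
        adabb_update (adabb_lambda f x k) (alpha k.-1) (theta k.-1)
                     (alpha k) (theta k)
    & forall k, (1 <= k)%N -> grad f (x k) <> grad f (x k.-1)].

(* In [adabb_M1] and [adabb_P1], a0 = alpha_0, a1 = alpha_1, l1 = lambda_1.
   The last branch is meant for 0 < l1 <= a0 / 2; lambda_1 > 0 always holds for
   a convex f with locally Lipschitz gradient. *)
Definition adabb_M1 (a0 a1 l1 : R) : R :=
  if a0 <= l1 then 0
  else if a0 / 2 < l1 then a1 ^+ 2 / (l1 * a0) - a1 ^+ 2 / a0 ^+ 2
  else a1 ^+ 2 / l1 ^+ 2 - a1 ^+ 2 / (a0 * l1).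

Definition adabb_P1 (a0 a1 l1 : R) : R :=
  if a0 <= l1 then a1 ^+ 2 / a0
  else if a0 / 2 < l1 then 2 * a1 ^+ 2 / a0 - a1 ^+ 2 / l1
  else a1 ^+ 2 / a0.

(* [xs] is a minimizer in all uses, so that f xs is the minimum of f. *)
Definition adabb_radius {n : nat} (f : 'rV[R]_n -> R) (x : nat -> 'rV[R]_n)
    (alpha : nat -> R) (xs : 'rV[R]_n) : R :=
  let M1 := adabb_M1 (alpha 0%N) (alpha 1%N) (adabb_lambda f x 1) in
  let P1 := adabb_P1 (alpha 0%N) (alpha 1%N) (adabb_lambda f x 1) in
  Num.sqrt (enorm (x 0%N - xs) ^+ 2
            + alpha 0%N ^+ 2 * (1 + 2 * M1) * enorm (grad f (x 0%N)) ^+ 2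
            + Num.max (2 * P1 - 2 * alpha 0%N) 0 * (f (x 0%N) - f xs)).

End adabb.

(* Main.v *)
Require Import Defs.
From mathcomp Require Import ring lra.

Import Order.TTheory GRing.Theory Num.Theory.

Local Open Scope classical_set_scope.
Local Open Scope ring_scope.

(** Write [g k] for the gradient at [x k] and [F k] for [f (x k) - f xs]. The
    stepsize rule is built so that, in each of its cases,
      [alpha k.+1 ^+ 2 * |g k.+1|^2
         <= M * alpha k ^+ 2 * |g k|^2 + P * alpha k * <g k.+1, g k>]
    with [0 <= M <= 1 / 2] and
    [P = alpha k.+1 * theta k.+1 <= alpha k * (1 + theta k)]
    ([step_spec_grad], [step_spec_bounds]). By convexity the inner product
    satisfies [alpha k * <g k.+1, g k> <= F k - F k.+1]. Substituting this in the
    expansion of [|x k.+2 - z|^2] shows that, for every minimizer [z],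
      [|x k.+1 - z|^2 + 2 alpha k (1 + theta k) F k + alpha k ^+ 2 |g k|^2]
    is nonincreasing in [k] ([adabb_descent], [lyapunov_decr]).

    For [z = xs] its value at [k = 1] is at most the square of the given radius,
    so the iterates never leave the ball where [f] is smooth. There
    [lambda >= 1 / L], hence the stepsizes are bounded below by a positive
    constant, and smoothness sharpens the decrease at each step by a multiple of
    [|g k|^2] ([adabb_invariant]). The squared gradients are therefore summable:
    this gives the rate, since [k] times their minimum is at most their sum, and
    it gives [F k --> 0], since [F k <= |g k| * |x k - xs|]. All cluster points
    are thus minimizers.

    The stepsizes may be unbounded, so the last two terms of the Lyapunov
    function need not vanish in the limit. They do not depend on [z], however,
    and this is enough for uniqueness of the cluster point ([fejer_cvg]). *)

(** * The stepsize rule *)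

Section step.
Context {R : realType}.
Implicit Types l a t A B C : R.

Let sqr_sqrt2 : Num.sqrt 2 ^+ 2 = 2 :> R.
Proof. by rewrite sqr_sqrtr. Qed.

Let sqrt2_gt0 : 0 < Num.sqrt 2 :> R.
Proof. by rewrite sqrtr_gt0. Qed.

(** A division-free form of the update rule with both options merged into the
    inequalities they have in common. The last two indices are the values of
    [adabb_M1] and [adabb_P1] in each case. *)
Variant step_spec l a t a' t' : R -> R -> Prop :=
  | StepLarge of a <= l & a' ^+ 2 = (1 + t) * a ^+ 2 & t' = a' / a :
      step_spec l a t a' t' 0 (a' ^+ 2 / a)
  | StepMedium of a / 2 < l & l < a & 2 * (a - l) * a' ^+ 2 <= l * a ^+ 2
      & (2 * l - a) * a' ^+ 2 <= (1 + t) * l * a ^+ 2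
      & t' = 2 * a' / a - a' / l :
      step_spec l a t a' t' (a' ^+ 2 / (l * a) - a' ^+ 2 / a ^+ 2)
        (2 * a' ^+ 2 / a - a' ^+ 2 / l)
  | StepSmall of l <= a / 2 & 2 * (a - l) * a' ^+ 2 <= a * l ^+ 2 & t' = a' / a :
      step_spec l a t a' t' (a' ^+ 2 / l ^+ 2 - a' ^+ 2 / (a * l)) (a' ^+ 2 / a).

Lemma ler_minl_sqr (a b c : R) :
  0 <= c -> a <= c \/ b ^+ 2 <= c ^+ 2 -> Num.min a b <= c.
Proof.
move=> c0 [ac|bc]; rewrite ge_min ?ac//; apply/orP; right.
have [b0|b0] := ltP b 0; first exact: le_trans (ltW b0) c0.
by rewrite -(ler_pXn2r (ltn0Sn 1)) ?nnegrE.
Qed.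

(** The new stepsize never drops below the smaller of the old one and
    [l / sqrt 2]. In the medium case this comes from [l * (a - l) <= a ^+ 2 / 4],
    in the small case from [a - l <= a]. Once [l] is bounded below along a run,
    so are the stepsizes. *)
Lemma adabb_updateP l a t a' t' : 0 < l -> 0 < a -> 0 <= t ->
  adabb_update l a t a' t' ->
  [/\ 0 < a', Num.min a (l / Num.sqrt 2) <= a'
    & step_spec l a t a' t' (adabb_M1 a a' l) (adabb_P1 a a' l)].
Proof.
move=> l0 a0 t0 [Hi Hii Hiii]; rewrite /adabb_M1 /adabb_P1.
have [al|la] := lerP a l.
  have [-> ->] := Hi al.
  have s0 : 1 <= Num.sqrt (1 + t) by rewrite -[leLHS]sqrtr1 ler_wsqrtr// lerDl.
  have a'0 : 0 < Num.sqrt (1 + t) * a by rewrite mulr_gt0// (lt_le_trans ltr01).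
  split=> //; first by rewrite ge_min ler_peMl// ltW.
  by apply: StepLarge => //; rewrite exprMn sqr_sqrtr// addr_ge0.
have [al2|la2] := ltrP (a / 2) l.
  have [a'E t'E] := Hii (introT andP (conj al2 la)).
  have al0 : 0 < a - l by rewrite subr_gt0.
  have al20 : 0 < 2 * l - a by lra.
  case: a'E => [a'E|a'E]; last first.
    rewrite a'E in t'E *; split=> //.
      apply: ler_minl_sqr; [exact: ltW | right].
      by rewrite expr_div_n sqr_sqrt2; nra.
    apply: StepMedium => //.
      have : 0 <= l * (l ^+ 2 + (a - l) ^+ 2) by rewrite mulr_ge0 ?addr_ge0 ?sqr_ge0 ?ltW.
      by lra.
    have : 0 <= (a - l) * (a + 2 * l) * l by rewrite !mulr_ge0 ?ltW//; lra.
    have : 0 <= t * l * a ^+ 2 by rewrite mulr_ge0 ?sqr_ge0// mulr_ge0// ltW.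
    by lra.
  set s1 := l / (2 * (a - l)) in a'E.
  set s2 := (1 + t) * l / (2 * l - a) in a'E.
  have s10 : 0 < s1 by rewrite divr_gt0// mulr_gt0.
  have t10 : 0 < 1 + t by lra.
  have s20 : 0 < s2 by rewrite divr_gt0// mulr_gt0.
  have m0 : 0 < Num.min (Num.sqrt s1) (Num.sqrt s2) by rewrite lt_min !sqrtr_gt0 s10.
  have m1 : Num.min (Num.sqrt s1) (Num.sqrt s2) ^+ 2 <= s1.
    rewrite -[leRHS](sqr_sqrtr (ltW s10)) ler_pXn2r ?nnegrE ?sqrtr_ge0 ?(ltW m0)//.
    by rewrite ge_min lexx.
  have m2 : Num.min (Num.sqrt s1) (Num.sqrt s2) ^+ 2 <= s2.
    rewrite -[leRHS](sqr_sqrtr (ltW s20)) ler_pXn2r ?nnegrE ?sqrtr_ge0 ?(ltW m0)//.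
    by rewrite ge_min lexx orbT.
  have a'0 : 0 < a' by rewrite a'E mulr_gt0.
  have s1E : 2 * (a - l) * s1 = l by rewrite /s1; field; rewrite lt0r_neq0.
  have s2E : (2 * l - a) * s2 = (1 + t) * l by rewrite /s2; field; rewrite lt0r_neq0.
  split=> //.
    apply: ler_minl_sqr; first exact: ltW.
    rewrite a'E expr_div_n sqr_sqrt2.
    have [ss|ss] := leP (Num.sqrt s1) (Num.sqrt s2); [right|left].
      rewrite exprMn sqr_sqrtr ?(ltW s10)//.
      rewrite -(ler_pM2l (_ : 0 < 2 * (a - l))) ?mulr_gt0//.
      rewrite [leRHS]mulrA s1E.
      have : 0 <= (a - l) ^+ 2 by exact: sqr_ge0.
      have -> : 2 * (a - l) * (l ^+ 2 / 2) = l * ((a - l) * l) by field.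
      by move=> _; rewrite ler_pM2l//; nra.
    rewrite ler_peMl ?ltW// -[X in X < _]sqrtr1 ltr_sqrt//.
    by rewrite /s2 ltr_pdivlMr//; nra.
  apply: StepMedium => //.
    by rewrite a'E exprMn mulrA ler_pM2r ?exprn_gt0// -[leRHS]s1E ler_pM2l ?mulr_gt0.
  by rewrite a'E exprMn mulrA ler_pM2r ?exprn_gt0// -[leRHS]s2E ler_pM2l.
have [a'E t'E] := Hiii la2.
have al0 : 0 < a - l by lra.
case: a'E => a'E.
  have s0 : 0 < a / (2 * (a - l)) by rewrite divr_gt0// mulr_gt0.
  have a'0 : 0 < a' by rewrite a'E mulr_gt0// sqrtr_gt0.
  have a'2 : 2 * (a - l) * a' ^+ 2 = a * l ^+ 2.
    by rewrite a'E exprMn sqr_sqrtr ?(ltW s0)//; field; rewrite lt0r_neq0.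
  split=> //; last by apply: StepSmall => //; rewrite a'2.
  apply: ler_minl_sqr; [exact: ltW|right].
  rewrite expr_div_n sqr_sqrt2 -(ler_pM2l (_ : 0 < 2 * (a - l))) ?mulr_gt0// a'2.
  by have := sqr_ge0 l; nra.
have a'0 : 0 < a' by rewrite a'E divr_gt0.
split=> //; first by rewrite a'E ge_min lexx orbT.
apply: StepSmall => //; rewrite a'E expr_div_n sqr_sqrt2.
by have := sqr_ge0 l; nra.
Qed.
 
(** In the medium case these bounds are the purpose of the two arguments of the
    minimum:
    [M <= 1 / 2] lets the old gradient term of the Lyapunov function absorb the
    term in [M], and [a' * t' <= a * (1 + t)] lets its old function value absorb
    the term in [P]. *)
Lemma step_spec_bounds l a t a' t' M P : 0 < l -> 0 < a -> 0 <= t -> 0 < a' ->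
  step_spec l a t a' t' M P ->
  [/\ 0 <= M <= 2^-1, P = a' * t', 0 <= t' & a' * t' <= a * (1 + t)].
Proof.
move=> l0 a0 t0 a'0 []; have a'20 : 0 < a' ^+ 2 by rewrite exprn_gt0.
- move=> al a'E t'E; split=> //; first by lra.
  + by rewrite t'E; field; rewrite lt0r_neq0.
  + by rewrite t'E divr_ge0 ?ltW.
  + rewrite t'E -(ler_pM2r a0).
    have -> : a' * (a' / a) * a = a' ^+ 2 by field; rewrite lt0r_neq0.
    by rewrite a'E; lra.
- move=> al2 la h1 h2 t'E; split.
  + have -> : a' ^+ 2 / (l * a) - a' ^+ 2 / a ^+ 2 = (a - l) * a' ^+ 2 / (l * a ^+ 2).
      by field; rewrite !lt0r_neq0.
    apply/andP; split.
      by rewrite divr_ge0 ?mulr_ge0 ?ltW ?exprn_gt0 ?subr_gt0.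
    by rewrite ler_pdivrMr ?mulr_gt0 ?exprn_gt0//; lra.
  + by rewrite t'E; field; rewrite !lt0r_neq0.
  + have -> : t' = a' * (2 * l - a) / (l * a) by rewrite t'E; field; rewrite !lt0r_neq0.
    by rewrite divr_ge0 ?mulr_ge0 ?ltW//; lra.
  + have -> : a' * t' = (2 * l - a) * a' ^+ 2 / (l * a).
      by rewrite t'E; field; rewrite !lt0r_neq0.
    by rewrite ler_pdivrMr ?mulr_gt0//; lra.
- move=> la h t'E; split.
  + have -> : a' ^+ 2 / l ^+ 2 - a' ^+ 2 / (a * l) = (a - l) * a' ^+ 2 / (a * l ^+ 2).
      by field; rewrite !lt0r_neq0.
    apply/andP; split.
      by rewrite divr_ge0 ?mulr_ge0 ?ltW ?exprn_gt0//; lra.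
    by rewrite ler_pdivrMr ?mulr_gt0 ?exprn_gt0//; lra.
  + by rewrite t'E; field; rewrite !lt0r_neq0.
  + by rewrite t'E divr_ge0 ?ltW.
  + rewrite t'E.
    have -> : a' * (a' / a) = a' ^+ 2 / a by field; rewrite !lt0r_neq0.
    have al : a <= 2 * (a - l) by lra.
    have h1 : a * a' ^+ 2 <= a * l ^+ 2.
      by apply: le_trans h; rewrite ler_pM2r.
    rewrite ler_pM2l// in h1.
    rewrite ler_pdivrMr//; apply: (le_trans h1).
    have : 0 <= t * a ^+ 2 by rewrite mulr_ge0 ?sqr_ge0.
    by nra.
Qed.

(** Here [A], [B], [C] stand for the squared norms of the old and new gradients
    [g] and [g'] and for their inner product. Since the step is [- a *: g], the
    definition of [l] is a linear relation between [A], [B] and [C], which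
    expresses [B] through [C] and [d = |g' - g|^2] or through [A] and [C]. In
    the large case the [d] term is nonpositive; in the medium case [d] is
    eliminated exactly; in the small case this elimination would give [C] a
    negative coefficient, and Cauchy-Schwarz bounds [d] by [a^2 A / l^2]. *)
Lemma step_spec_grad l a t a' t' M P A B C : 0 < l -> 0 < a ->
  step_spec l a t a' t' M P -> 0 < A + B - C *+ 2 ->
  l * (A + B - C *+ 2) = a * (A - C) ->
  C ^+ 2 <= A * B ->
  a' ^+ 2 * B <= M * (a ^+ 2 * A) + P * (a * C).
Proof.
move=> l0 a0 sp d0 lE CS; have a'20 : 0 <= a' ^+ 2 by exact: sqr_ge0.
set d := A + B - C *+ 2 in d0 lE.
have CE : C = A - l * d / a by rewrite lE; field; rewrite lt0r_neq0.
have BE : B = C + d * (1 - l / a).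
  have -> : B = d - A + 2 * C by rewrite /d; ring.
  by rewrite [in RHS]CE [in LHS]CE; field; rewrite lt0r_neq0.
case: sp.
- move=> al _ _; rewrite mul0r add0r.
  have -> : a' ^+ 2 / a * (a * C) = a' ^+ 2 * C by field; rewrite lt0r_neq0.
  apply: ler_wpM2l => //; rewrite BE gerDl.
  by rewrite mulr_ge0_le0 ?(ltW d0)// subr_le0 ler_pdivlMr// mul1r.
- move=> _ la _ _ _.
  rewrite le_eqVlt; apply/orP; left; apply/eqP.
  have -> : B = A * (a - l) / l + C * (2 * l - a) / l.
    have dE : d = a * (A - C) / l by rewrite -lE; field; rewrite lt0r_neq0.
    by rewrite BE dE; field; rewrite !lt0r_neq0.
  by field; rewrite !lt0r_neq0.
- move=> la h _.
  (* Cauchy-Schwarz for [l * d = - a * dotp (g' - g) g], divided by [d]. *)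
  have dA : l ^+ 2 * d <= a ^+ 2 * A.
    rewrite -(ler_pM2r d0).
    have -> : l ^+ 2 * d * d = a ^+ 2 * (A - C) ^+ 2 by rewrite -exprMn -lE; ring.
    rewrite -[leRHS]mulrA ler_pM2l ?exprn_gt0// /d.
    by lra.
  have -> : a' ^+ 2 / a * (a * C) = a' ^+ 2 * C by field; rewrite lt0r_neq0.
  rewrite [in leLHS]BE mulrDr addrC lerD2r.
  have -> : (a' ^+ 2 / l ^+ 2 - a' ^+ 2 / (a * l)) * (a ^+ 2 * A) =
            a' ^+ 2 * ((1 - l / a) / l ^+ 2 * (a ^+ 2 * A)) by field; rewrite !lt0r_neq0.
  apply: ler_wpM2l => //.
  have -> : d * (1 - l / a) = (1 - l / a) / l ^+ 2 * (l ^+ 2 * d) by field; rewrite !lt0r_neq0.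
  apply: ler_wpM2l => //; rewrite divr_ge0 ?sqr_ge0// subr_ge0 ler_pdivrMr//.
  by lra.
Qed.

End step.

(** * Euclidean inner product *)

Section euclid.
Context {R : realType} {n : nat}.
Implicit Types (u v w p q z : 'rV[R]_n) (c : R).

Lemma dotpC u v : dotp u v = dotp v u.
Proof. by apply: eq_bigr => i _; rewrite mulrC. Qed.

Lemma dotpDl u v w : dotp (u + v) w = dotp u w + dotp v w.
Proof. by rewrite -big_split; apply: eq_bigr => i _; rewrite mxE mulrDl. Qed.

Lemma dotpZl c u w : dotp (c *: u) w = c * dotp u w.
Proof. by rewrite mulr_sumr; apply: eq_bigr => i _; rewrite mxE mulrA. Qed.

Lemma dotpNl u w : dotp (- u) w = - dotp u w.
Proof. by rewrite -scaleN1r dotpZl mulN1r. Qed.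

Lemma dotpDr u v w : dotp u (v + w) = dotp u v + dotp u w.
Proof. by rewrite dotpC dotpDl !(dotpC u). Qed.

Lemma dotpZr c u w : dotp u (c *: w) = c * dotp u w.
Proof. by rewrite dotpC dotpZl dotpC. Qed.

Lemma dotpNr u w : dotp u (- w) = - dotp u w.
Proof. by rewrite dotpC dotpNl dotpC. Qed.

Definition dotpE := (dotpDl, dotpDr, dotpZl, dotpZr, dotpNl, dotpNr).

Lemma dotpp_ge0 u : 0 <= dotp u u.
Proof. by apply: sumr_ge0 => i _; rewrite -expr2 sqr_ge0. Qed.

Lemma sqr_enorm u : enorm u ^+ 2 = dotp u u.
Proof. by rewrite sqr_sqrtr ?dotpp_ge0. Qed.

Lemma sqr_coord_le u i : u 0 i ^+ 2 <= dotp u u.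
Proof.
rewrite /dotp (bigD1 i)//= -expr2 lerDl sumr_ge0// => j _.
by rewrite -expr2 sqr_ge0.
Qed.

Lemma dotpp_eq0 u : dotp u u = 0 -> u = 0.
Proof.
move=> u0; apply/rowP => i; rewrite mxE; apply/eqP.
by rewrite -sqrf_eq0 eq_le sqr_ge0 andbT -u0 sqr_coord_le.
Qed.

Lemma dotp_sqr_le u v : dotp u v ^+ 2 <= dotp u u * dotp v v.
Proof.
have [v0|v0] := eqVneq (dotp v v) 0.
  rewrite (dotpp_eq0 v v0) -(scale0r (0 : 'rV[R]_n)) dotpZr mul0r expr0n.
  by rewrite mulr_ge0// dotpp_ge0.
have vv0 : 0 < dotp v v by rewrite lt0r v0 dotpp_ge0.
have := dotpp_ge0 (dotp v v *: u - dotp u v *: v).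
rewrite !dotpE (dotpC v u) => H.
by rewrite -subr_ge0 -(pmulr_rge0 _ vv0); lra.
Qed.

Lemma dotp00 : dotp 0 (0 : 'rV[R]_n) = 0.
Proof. by rewrite -(scale0r (0 : 'rV[R]_n)) dotpZl mul0r. Qed.

Lemma eball_sqrt z u c : dotp (u - z) (u - z) <= c -> eball z (Num.sqrt c) u.
Proof. exact: ler_wsqrtr. Qed.

End euclid.

(** * Cluster points and convergence of sequences *)

Section cluster_points.
Context {R : realType} {n : nat}.
Implicit Types (u v w p q z : 'rV[R]_n).

Lemma dotpp_continuous : continuous (fun u : 'rV[R]_n => dotp u u).
Proof.
move=> u.
have sqr_coord (i : 'I_n) : xpredT i ->
    (fun v : 'rV[R]_n => v 0 i * v 0 i) v @[v --> u] --> u 0 i * u 0 i.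
  by move=> _; apply: (@cvgM R _ (nbhs u)); exact: (@coord_continuous R 1 n 0 i u).
exact: (cvg_big (U := R) (r := index_enum 'I_n)
  (@add_continuous R^o) _ sqr_coord).
Qed.

Lemma sqr_dist_continuous z : continuous (fun u => dotp (u - z) (u - z)).
Proof.
move=> u; apply: (@continuous_comp _ _ _ (fun v : 'rV[R]_n => v - z)
  (fun v : 'rV[R]_n => dotp v v)); last exact: dotpp_continuous.
by apply: continuousB; [apply: (@cvg_id _ (nbhs u)) | exact: cst_continuous].
Qed.

Lemma cluster_lim (x : nat -> 'rV[R]_n) (h : 'rV[R]_n -> R) p l :
  cluster (x @ \oo) p -> {for p, continuous h} -> h (x k) @[k --> \oo] --> l ->
  h p = l.
Proof.
rewrite cluster_cvgE => -[G GF [Gp xG]] hp hl.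
apply: (@cvg_unique _ (@norm_hausdorff _ R^o) (h @ G)).
  exact: cvg_trans (cvg_app h Gp) hp.
by apply: cvg_trans hl => A; exact: xG.
Qed.

Lemma mx_norm_le_dotp u (c : R) : 0 <= c -> dotp u u <= c ^+ 2 -> `|u| <= c.
Proof.
move=> c0 uc; rewrite [`|u|]mx_normrE; apply: bigmax_le => //= -[i j] _ /=.
rewrite (ord1 i) -(ler_pXn2r (ltn0Sn 1)) ?nnegrE// real_normK ?num_real//.
exact: le_trans (sqr_coord_le u j) uc.
Qed.

(** The Euclidean bound puts the sequence in a closed ball for the sup norm,
    which is compact; a filter on a compact set with a single cluster
    point converges to it. *)
Lemma bounded_cluster_cvg (x : nat -> 'rV[R]_n) z (c : R) :
  (forall k, dotp (x k - z) (x k - z) <= c) ->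
  (forall p q, cluster (x @ \oo) p -> cluster (x @ \oo) q -> p = q) ->
  exists2 p, cluster (x @ \oo) p & x k @[k --> \oo] --> p.
Proof.
move=> xc uniq_cluster.
(* [r ^+ 2] dominates [c] without taking a square root. *)
set r := 1 + c.
have c0 : 0 <= c by apply: le_trans (xc 0%N); exact: dotpp_ge0.
have r0 : 0 <= r by rewrite addr_ge0.
have xr k : `|x k - z| <= r.
  apply: mx_norm_le_dotp => //; apply: le_trans (xc k) _; rewrite /r.
  by have := sqr_ge0 c; nra.
have kpt (e : R) : compact (closed_ball_ Num.norm z e).
  apply: bounded_closed_compact; last exact: closed_closed_ball_.
  exists (`|z| + e); split; first exact: num_real.
  move=> M zeM u /= zu; apply: le_trans (ltW zeM).
  by rewrite -[u](subrKC z) (le_trans (ler_normD _ _))// lerD2l distrC.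
have xF e : r <= e -> (x @ \oo) (closed_ball_ Num.norm z e).
  move=> re; exists 0%N => // k _; rewrite /closed_ball_/= distrC.
  exact: le_trans (xr k) re.
have [p [_ xp]] := kpt r (x @ \oo) _ (xF r (lexx _)).
exists p => //.
have cE : cluster (x @ \oo) = [set p].
  by apply/seteqP; split=> [q /uniq_cluster|q ->//]; apply.
(* The ball must be a neighbourhood of [p], hence the extra [|z - p| + 1]. *)
apply: (compact_cluster_set1 _ (kpt (`|z - p| + (1 + r)))) => //.
- near=> u; rewrite /closed_ball_/=.
  rewrite -(subrKA p) (le_trans (ler_normD _ _))// lerD2l.
  have : `|p - u| < 1 by near: u; exact: (cvgr_dist_lt id p (@cvg_id _ (nbhs p)) 1 ltr01).
  by move=> /ltW pu; rewrite (le_trans pu)// lerDl.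
- by apply: xF; rewrite addrA lerDr addr_ge0.
Unshelve. all: by end_near. Qed.

End cluster_points.

Section fejer.
Context {R : realType} {n : nat}.
Implicit Types (u v w p q z : 'rV[R]_n).

(** Opial's argument. The summand [W] does not depend on the centre, so for two
    cluster points [p] and [q] it cancels from the difference of the two
    convergent sequences. The difference of the squared distances to [p] and to
    [q] thus converges, and it takes the opposite values [- |p - q|^2] and
    [|p - q|^2] at [p] and [q]. In particular [W] need not tend to [0]. *)
Lemma fejer_cvg (x : nat -> 'rV[R]_n) (W : nat -> R) (S : set 'rV[R]_n) z (c : R) :
  (forall k, dotp (x k - z) (x k - z) <= c) ->
  cluster (x @ \oo) `<=` S ->
  (forall p, S p -> cvgn (fun k => dotp (x k - p) (x k - p) + W k)) ->
  exists2 p, S p & x k @[k --> \oo] --> p.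
Proof.
move=> xc clS VC; suff [p /clS Sp xp] : exists2 p, cluster (x @ \oo) p &
    x k @[k --> \oo] --> p by exists p.
apply: (bounded_cluster_cvg x z c) => // p q xp xq.
pose h u := dotp (u - p) (u - p) - dotp (u - q) (u - q).
have hcont : continuous h.
  by move=> u; apply: (@cvgB R R^o _ (nbhs u)); exact: sqr_dist_continuous.
have hcvg : cvgn (fun k => h (x k)).
  have -> : (fun k => h (x k)) = (fun k => dotp (x k - p) (x k - p) + W k)
      - (fun k => dotp (x k - q) (x k - q) + W k).
    by apply/funext => k; rewrite /h/= opprD addrACA subrr addr0.
  by apply: is_cvgB; apply: VC; exact: clS.
have hp := cluster_lim x h p _ xp (hcont p) hcvg.
have hq := cluster_lim x h q _ xq (hcont q) hcvg.
have : h p = h q by rewrite hp hq.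
rewrite /h !subrr -(opprB p q) !dotpE opprK.
rewrite dotp00 => H.
apply/eqP; rewrite -subr_eq0; apply/eqP/dotpp_eq0; rewrite !dotpE; lra.
Qed.

End fejer.

(** * Gradients of convex functions *)

Section gradient.
Context {R : realType} {n : nat}.
Implicit Types (u v w p q z : 'rV[R]_n) (f : 'rV[R]_n -> R).

Lemma derive_grad f u w : differentiable f u -> 'D_w f u = dotp (grad f u) w.
Proof.
move=> df; rewrite deriveE// {1}(row_sum_delta w) linear_sum.
by apply: eq_bigr => i _; rewrite linearZ/= mxE deriveE// mulrC.
Qed.

Lemma cvg_slope_grad f u w : differentiable f u ->
  h^-1 * (f (u + h *: w) - f u) @[h --> 0^'+] --> dotp (grad f u) w.
Proof.
move=> df; rewrite -derive_grad//; apply: cvg_dnbhs_at_right.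
have -> : (fun h => h^-1 * (f (u + h *: w) - f u)) =
          (fun h => h^-1 *: ((f \o shift u) (h *: w) - f u)).
  by apply/funext => h /=; rewrite [u + _]addrC.
exact: diff_derivable.
Qed.

(** The slopes of a convex function along a segment are at most its last slope,
    so the same holds for their limit. *)
Lemma convex_grad_le f u v : differentiable f v ->
  convex_function [set: convex_lmodType 'rV[R]_n] f ->
  dotp (grad f v) (u - v) <= f u - f v.
Proof.
move=> df cf; apply: (cvgr_to_le (cvg_slope_grad f v (u - v) df)).
near=> h.
have h0 : 0 < h by [].
have h1 : h <= 1 by near: h; exact: nbhs_right_le.
have := cf (Itv01 (ltW h0) h1) u v; rewrite !inE => /(_ I I).
rewrite convRE /conv/= => H.
rewrite mulrC ler_pdivrMr// lerBlDr.
have -> : v + h *: (u - v) = h *: u + (1 - h) *: v.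
  by rewrite scalerBr scalerBl scale1r addrCA addrA.
by apply: le_trans H _; rewrite /unstable.onem; lra.
Unshelve. all: by end_near. Qed.

Lemma minimizer_grad0 f z : differentiable f z -> minimizers f z -> grad f z = 0.
Proof.
move=> df zmin; apply: dotpp_eq0; apply/eqP; rewrite eq_le dotpp_ge0 andbT.
rewrite -oppr_ge0 -dotpNr; apply: (cvgr_to_ge (cvg_slope_grad f z _ df)).
near=> h; rewrite mulr_ge0 ?subr_ge0 ?zmin// invr_ge0 ltW//.
Unshelve. all: by end_near. Qed.

End gradient.

(** * One step of the algorithm *)

Section run.
Context {R : realType} {n : nat} (f : 'rV[R]_n -> R).
Context (x : nat -> 'rV[R]_n) (alpha theta : nat -> R).

Lemma adabb_lambdaM k : grad f (x k.+1) <> grad f (x k) ->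
  0 < dotp (grad f (x k.+1) - grad f (x k)) (grad f (x k.+1) - grad f (x k)) /\
  adabb_lambda f x k.+1 *
    dotp (grad f (x k.+1) - grad f (x k)) (grad f (x k.+1) - grad f (x k)) =
  dotp (grad f (x k.+1) - grad f (x k)) (x k.+1 - x k).
Proof.
move=> gE; rewrite /adabb_lambda sqr_enorm/=; set d := dotp (_ - _) (_ - _).
have d0 : d != 0.
  by apply/eqP => /dotpp_eq0 /eqP; rewrite subr_eq0 => /eqP.
by split; [rewrite lt0r d0 dotpp_ge0 | rewrite divfK].
Qed.

(** Adding the smoothness inequality to itself with the two points exchanged
    gives cocoercivity of the gradient, and [lambda] is the best constant in it
    for this pair. *)
Lemma adabb_lambda_ge (L : R) k : 0 < L -> grad f (x k.+1) <> grad f (x k) ->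
  (forall u v, (u = x k.+1 /\ v = x k) \/ (u = x k /\ v = x k.+1) ->
    f u - f v - dotp (grad f v) (u - v) >=
      1 / (2 * L) * enorm (grad f u - grad f v) ^+ 2) ->
  1 / L <= adabb_lambda f x k.+1.
Proof.
move=> L0 /adabb_lambdaM[d0 dE] H.
have := H _ _ (or_introl (conj erefl erefl)).
have := H _ _ (or_intror (conj erefl erefl)).
move=> H1 H2; rewrite -(ler_pM2r d0) dE; move: H1 H2; rewrite -(opprB (x k.+1)).
move: (grad f (x k.+1)) (grad f (x k)) (x k.+1 - x k) => g' g y.
have -> : 1 / L = 2 * (1 / (2 * L)) by field; rewrite lt0r_neq0.
rewrite (sqr_enorm (g - g')) (sqr_enorm (g' - g)) !dotpE (dotpC g g') => H1 H2.
by lra.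
Qed.

(** The value with index [k] measures the pair [x k], [x k.+1]; only its first
    term depends on the choice of minimizer [z]. *)
Definition lyapunov z k :=
  dotp (x k.+1 - z) (x k.+1 - z)
  + 2 * (alpha k * (1 + theta k)) * (f (x k) - f z)
  + alpha k ^+ 2 * dotp (grad f (x k)) (grad f (x k)).

Context (f_convex : convex_function [set: convex_lmodType 'rV[R]_n] f)
  (f_diff : forall u, differentiable f u).
Context (run : adabb f x alpha theta).

Local Notation M k := (adabb_M1 (alpha k) (alpha k.+1) (adabb_lambda f x k.+1)).
Local Notation P k := (adabb_P1 (alpha k) (alpha k.+1) (adabb_lambda f x k.+1)).

(** Expand the squared distance of [x k.+2] to [z]. Counting the squared
    gradient term twice and subtracting it once leaves one copy on the left for
    the next step, while [step_spec_grad] bounds the two copies on the right.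
    Convexity turns the inner product of the two gradients into a decrease of
    [f], since the step goes along the old gradient. The slack [s] is [0] for a
    general minimizer and positive where smoothness is available. *)
Lemma adabb_descent k z s : 0 < adabb_lambda f x k.+1 -> 0 < alpha k -> 0 <= theta k ->
  f (x k.+1) - f z + s <= dotp (grad f (x k.+1)) (x k.+1 - z) ->
  lyapunov z k.+1 + 2 * alpha k.+1 * s <=
   dotp (x k.+1 - z) (x k.+1 - z)
   + 2 * M k * (alpha k ^+ 2 * dotp (grad f (x k)) (grad f (x k)))
   + 2 * P k * (f (x k) - f z).
Proof.
move=> l0 a0 t0 fs; set M := M k; set P := P k; case: run => _ _ xE upd gE.
have [a'0 _ sp] := adabb_updateP _ _ _ _ _ l0 a0 t0 (upd k.+1 isT).
have [_ PE t'0 _] := step_spec_bounds _ _ _ _ _ _ _ l0 a0 t0 a'0 sp.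
have [d0 lE] := adabb_lambdaM k (gE k.+1 isT).
have := step_spec_grad _ _ _ _ _ _ _ (dotp (grad f (x k)) (grad f (x k)))
  (dotp (grad f (x k.+1)) (grad f (x k.+1))) (dotp (grad f (x k.+1)) (grad f (x k)))
  l0 a0 sp.
rewrite -/M -/P; rewrite -/M -/P in PE.
set A := dotp (grad f (x k)) (grad f (x k)).
set B := dotp (grad f (x k.+1)) (grad f (x k.+1)).
set C := dotp (grad f (x k.+1)) (grad f (x k)).
have dE : dotp (grad f (x k.+1) - grad f (x k)) (grad f (x k.+1) - grad f (x k)) =
  A + B - C *+ 2.
  by rewrite !dotpE (dotpC (grad f (x k)) (grad f (x k.+1))) -/A -/B -/C; lra.
rewrite dE in d0 lE.
move=> /(_ d0) H.
have {H} : alpha k.+1 ^+ 2 * B <= M * (alpha k ^+ 2 * A) + P * (alpha k * C).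
  apply: H.
    rewrite lE [in X in dotp _ X]xE addrAC subrr add0r.
    by rewrite !dotpE -/A -/C; lra.
  by rewrite mulrC; exact: dotp_sqr_le.
have CF : alpha k * C <= f (x k) - f (x k.+1).
  have := convex_grad_le f (x k) (x k.+1) (f_diff _) f_convex.
  have -> : x k - x k.+1 = alpha k *: grad f (x k) by rewrite xE subKr.
  by rewrite dotpZr.
have P0 : 0 <= P by rewrite PE mulr_ge0// ltW.
have PCF : P * (alpha k * C) <= P * (f (x k) - f (x k.+1)) by exact: ler_wpM2l.
have a's : alpha k.+1 * (f (x k.+1) - f z + s) <=
  alpha k.+1 * dotp (grad f (x k.+1)) (x k.+1 - z) by rewrite ler_pM2l.
rewrite /lyapunov -/B (xE k.+1) [x k.+1 - _ - z]addrAC.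
move: (x k.+1 - z) a's => y a's.
rewrite !dotpE (dotpC y (grad f (x k.+1))) -/B.
have -> : 2 * (alpha k.+1 * (1 + theta k.+1)) = 2 * alpha k.+1 + 2 * P by rewrite PE; ring.
by lra.
Qed.

Lemma lyapunov_decr k z s : 0 < adabb_lambda f x k.+1 -> 0 < alpha k -> 0 <= theta k ->
  minimizers f z -> f (x k.+1) - f z + s <= dotp (grad f (x k.+1)) (x k.+1 - z) ->
  lyapunov z k.+1 + 2 * alpha k.+1 * s <= lyapunov z k.
Proof.
move=> l0 a0 t0 zmin fs; apply: le_trans (adabb_descent k z s l0 a0 t0 fs) _.
case: run => _ _ xE upd gE.
have [a'0 _ sp] := adabb_updateP _ _ _ _ _ l0 a0 t0 (upd k.+1 isT).
have [/andP[_ M2] PE t'0 aa'] := step_spec_bounds _ _ _ _ _ _ _ l0 a0 t0 a'0 sp.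
rewrite /lyapunov -addrA -[leRHS]addrA lerD2l addrC lerD//.
  rewrite ler_wpM2r ?subr_ge0 ?zmin// ler_pM2l// PE//.
rewrite ler_piMl ?mulr_ge0 ?sqr_ge0 ?dotpp_ge0//; lra.
Qed.

End run.

(** * Boundedness of the run *)

(** This holds whatever the sign of [l]; it is needed to place [x 0] and [x 1]
    in the ball, from which the positivity of [l] is then derived. *)
Lemma adabb_M1_ge0 {R : realType} (a a' l : R) : 0 < a -> 0 <= adabb_M1 a a' l.
Proof.
move=> a0; rewrite /adabb_M1; have [//|la] := leP a l.
have [al|la2] := ltP (a / 2) l.
  have l0 : 0 < l by lra.
  have -> : a' ^+ 2 / (l * a) - a' ^+ 2 / a ^+ 2 = a' ^+ 2 * (a - l) / (l * a ^+ 2).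
    by field; rewrite !lt0r_neq0.
  by rewrite divr_ge0// mulr_ge0 ?sqr_ge0// ?subr_ge0 ltW.
rewrite -exprVn invfM -mulrBr mulr_ge0 ?sqr_ge0//.
have -> : l^-1 ^+ 2 - a^-1 * l^-1 = l^-1 * (l^-1 - a^-1) by ring.
have [l0|l0] := ltP 0 l.
  by rewrite mulr_ge0 ?invr_ge0 ?(ltW l0)// subr_ge0 lef_pV2 ?posrE ?ltW.
have li0 : l^-1 <= 0 by rewrite invr_le0.
by rewrite mulr_le0// subr_le0 (le_trans li0)// invr_ge0 ltW.
Qed.

Section bounded_run.
Context {R : realType} {n : nat} (f : 'rV[R]_n -> R) (xs : 'rV[R]_n).
Context (x : nat -> 'rV[R]_n) (alpha theta : nat -> R) (L : R).
Context (f_convex : convex_function [set: convex_lmodType 'rV[R]_n] f)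
  (f_diff : forall u, differentiable f u) (xs_min : minimizers f xs)
  (run : adabb f x alpha theta) (L0 : 0 < L)
  (smooth : {in eball xs (adabb_radius f x alpha xs) &, forall u v : 'rV[R]_n,
      f u - f v - dotp (grad f v) (u - v)
        >= 1 / (2 * L) * enorm (grad f u - grad f v) ^+ 2}).

Local Notation r2 := (enorm (x 0%N - xs) ^+ 2
  + alpha 0%N ^+ 2
    * (1 + 2 * adabb_M1 (alpha 0%N) (alpha 1%N) (adabb_lambda f x 1))
    * enorm (grad f (x 0%N)) ^+ 2
  + Num.max (2 * adabb_P1 (alpha 0%N) (alpha 1%N) (adabb_lambda f x 1)
             - 2 * alpha 0%N) 0 * (f (x 0%N) - f xs)).

Local Notation alpha_min := (Num.min (alpha 0%N) (1 / L / Num.sqrt 2)).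

Let smooth_le u v : dotp (u - xs) (u - xs) <= r2 -> dotp (v - xs) (v - xs) <= r2 ->
  f u - f v - dotp (grad f v) (u - v) >= 1 / (2 * L) * enorm (grad f u - grad f v) ^+ 2.
Proof. by move=> ur vr; apply: smooth; rewrite inE; exact: eball_sqrt. Qed.

Lemma adabb_radius_ge0 : 0 <= r2.
Proof.
case: run => a0 _ _ _ _.
have M0 := adabb_M1_ge0 (alpha 0%N) (alpha 1%N) (adabb_lambda f x 1) a0.
apply: addr_ge0; last by rewrite mulr_ge0 ?subr_ge0 ?xs_min// le_max lexx orbT.
apply: addr_ge0; first exact: sqr_ge0.
by apply: mulr_ge0 (sqr_ge0 _); rewrite mulr_ge0 ?sqr_ge0//; lra.
Qed.

Lemma adabb_init :
  dotp (x 0%N - xs) (x 0%N - xs) <= r2 /\ dotp (x 1%N - xs) (x 1%N - xs) <= r2.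
Proof.
case: run => a0 _ xE _ _.
have M0 := adabb_M1_ge0 (alpha 0%N) (alpha 1%N) (adabb_lambda f x 1) a0.
rewrite !sqr_enorm.
have A0 := mulr_ge0 (sqr_ge0 (alpha 0%N)) (dotpp_ge0 (grad f (x 0%N))).
have MA0 := mulr_ge0 M0 A0.
have F0 : 0 <= f (x 0%N) - f xs by rewrite subr_ge0 xs_min.
set m := Num.max _ _.
have m0 : 0 <= m by rewrite le_max lexx orbT.
have mF0 := mulr_ge0 m0 F0.
have gx : 0 <= alpha 0%N * dotp (grad f (x 0%N)) (x 0%N - xs).
  rewrite mulr_ge0 ?(ltW a0)//; have := convex_grad_le f xs (x 0%N) (f_diff _) f_convex.
  by rewrite -(opprB (x 0%N)) dotpNr; lra.
split; first by lra.
rewrite xE [x 0%N - _ - xs]addrAC; move: (x 0%N - xs) gx => y gx.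
by rewrite !dotpE (dotpC y); lra.
Qed.

(** All parts are proved together, because each feeds the others: two
    consecutive iterates in the ball make the next [lambda] at least [1 / L],
    which makes the next stepsize positive and the Lyapunov function decrease,
    which keeps the next iterate in the ball. The radius is chosen so that the
    first Lyapunov value already lies below [r2]; the sum of squared gradients
    collects the slack of [1 / (2 * L)] that smoothness adds to each step. *)
Lemma adabb_invariant k :
  [/\ 0 < alpha k, 0 <= theta k, 1 / L <= adabb_lambda f x k.+1,
      alpha_min <= alpha k
    & [/\ dotp (x k - xs) (x k - xs) <= r2, dotp (x k.+1 - xs) (x k.+1 - xs) <= r2
      & (1 <= k)%N -> lyapunov f x alpha theta xs k +
         \sum_(0 <= i < k) alpha_min / L * dotp (grad f (x i.+1)) (grad f (x i.+1)) <= r2]].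
Proof.
case: (run) => a00 t00 xE upd gE.
have lambda_ge k' : dotp (x k' - xs) (x k' - xs) <= r2 ->
    dotp (x k'.+1 - xs) (x k'.+1 - xs) <= r2 -> 1 / L <= adabb_lambda f x k'.+1.
  move=> h1 h2; apply: adabb_lambda_ge => //; first exact: gE.
  by move=> u v [[-> ->]|[-> ->]]; exact: smooth_le.
have Li0 : 0 < 1 / L by rewrite divr_gt0.
elim: k => [|k [a0 t0 lL ac [D0 D1 V]]].
  have [D0 D1] := adabb_init.
  by split=> //; [exact: lambda_ge | rewrite ge_min lexx].
have l0 : 0 < adabb_lambda f x k.+1 by exact: lt_le_trans lL.
have [a'0 aa' sp] := adabb_updateP _ _ _ _ _ l0 a0 t0 (upd k.+1 isT).
have [_ PE t'0 _] := step_spec_bounds _ _ _ _ _ _ _ l0 a0 t0 a'0 sp.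
set s := 1 / (2 * L) * dotp (grad f (x k.+1)) (grad f (x k.+1)).
have fs : f (x k.+1) - f xs + s <= dotp (grad f (x k.+1)) (x k.+1 - xs).
  have xsr : dotp (xs - xs) (xs - xs) <= r2.
    by rewrite subrr dotp00 adabb_radius_ge0.
  have := smooth_le xs (x k.+1) xsr D1.
  rewrite (minimizer_grad0 f xs)// sub0r -(opprB (x k.+1)) dotpNr sqr_enorm.
  by rewrite dotpNl dotpNr opprK -/s; lra.
have ac' : alpha_min <= alpha k.+1.
  apply: le_trans aa'; rewrite le_min ac/=.
  by rewrite ge_min [X in _ || X]ler_wpM2r ?orbT// invr_ge0.
have alpha_min0 : 0 <= alpha_min by rewrite le_min !mulr_ge0 ?invr_ge0 ?ltW.
have sE : alpha_min / L * dotp (grad f (x k.+1)) (grad f (x k.+1)) <= 2 * alpha k.+1 * s.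
  have -> : 2 * alpha k.+1 * s =
      alpha k.+1 / L * dotp (grad f (x k.+1)) (grad f (x k.+1)).
    by rewrite /s; field; rewrite lt0r_neq0.
  by rewrite ler_wpM2r ?dotpp_ge0// ler_wpM2r// invr_ge0 ltW.
have V' : lyapunov f x alpha theta xs k.+1 +
    \sum_(0 <= i < k.+1) alpha_min / L * dotp (grad f (x i.+1)) (grad f (x i.+1)) <= r2.
  rewrite big_nat_recr//= [\sum_(_ <= _ < _) _ + _]addrC addrA.
  apply: (@le_trans _ _ (lyapunov f x alpha theta xs k.+1 + 2 * alpha k.+1 * s +
      \sum_(0 <= i < k) alpha_min / L * dotp (grad f (x i.+1)) (grad f (x i.+1)))).
    by rewrite lerD2r lerD2l.
  case: k => [|k] in a0 t0 lL ac D0 D1 V l0 a'0 aa' sp PE t'0 s fs sE ac' *; last first.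
    apply: le_trans (V isT); rewrite lerD2r.
    by apply: lyapunov_decr.
  (* At the first step the right-hand side of [adabb_descent] is compared with
     [r2] directly; the constants of the radius come from here. *)
  rewrite big_geq// addr0.
  apply: le_trans (adabb_descent f x alpha theta f_convex f_diff run 0 xs s l0 a0 t0 fs) _.
  rewrite [in dotp _ _]xE [x 0%N - _ - xs]addrAC !sqr_enorm.
  have := convex_grad_le f xs (x 0%N) (f_diff _) f_convex.
  rewrite -(opprB (x 0%N)) dotpNr.
  have F0 : 0 <= f (x 0%N) - f xs by rewrite subr_ge0 xs_min.
  set m := Num.max _ _.
  have : m * (f (x 0%N) - f xs) >= (2 * adabb_P1 (alpha 0%N) (alpha 1%N) (adabb_lambda f x 1)
             - 2 * alpha 0%N) * (f (x 0%N) - f xs) by rewrite ler_wpM2r// le_max lexx.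
  move: (x 0%N - xs) => y mF Fy.
  have : alpha 0%N * - dotp (grad f (x 0%N)) y <= alpha 0%N * (f xs - f (x 0%N)).
    by rewrite ler_pM2l.
  by rewrite !dotpE (dotpC y); lra.
have D2 : dotp (x k.+2 - xs) (x k.+2 - xs) <= r2.
  apply: le_trans V'; rewrite /lyapunov -!addrA lerDl !addr_ge0//.
  - by rewrite mulr_ge0 ?subr_ge0 ?xs_min// !mulr_ge0 ?addr_ge0// ltW.
  - by rewrite mulr_ge0 ?sqr_ge0 ?dotpp_ge0.
  - by rewrite sumr_ge0// => i _; rewrite !mulr_ge0 ?dotpp_ge0 ?invr_ge0 ?(ltW L0).
split; [exact: a'0 | exact: t'0 | exact: lambda_ge D1 D2 | exact: ac' |].
by split; [exact: D1 | exact: D2 | move=> _; exact: V'].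
Qed.

End bounded_run.

(** * Convergence and rate *)

Lemma min_le_sum {R : realDomainType} (b : nat -> R) (b0 : R) k :
  k%:R * \big[Num.min/b0]_(1 <= i < k.+1) b i <= \sum_(0 <= i < k) b i.+1.
Proof.
rewrite big_add1/=.
set m := \big[_/_]_(_ <= _ < _) _.
have -> : k%:R * m = \sum_(0 <= i < k) m.
  by rewrite sumr_const_nat subn0 mulr_natl.
rewrite !big_mkord; apply: ler_sum => i _; rewrite /m big_mkord.
exact: bigmin_le.
Qed.

Lemma cvg0_bounded_sum {R : realType} (b : nat -> R) (C : R) :
  (forall k, 0 <= b k) -> (forall k, \sum_(0 <= i < k) b i <= C) ->
  b k @[k --> \oo] --> 0.
Proof.
move=> b0 bC; apply: (@cvg_series_cvg_0 R R^o).
apply: nondecreasing_is_cvgn.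
  by apply/nondecreasing_seqP => k; rewrite /series/= big_nat_recr//= lerDl.
by exists C => _ [k _ <-]; exact: bC.
Qed.

Theorem theorem3p2 (R : realType) (n : nat) (f : 'rV[R]_n -> R)
  (f_convex : convex_function [set: convex_lmodType 'rV[R]_n] f)
  (f_diff : forall u : 'rV[R]_n, differentiable f u)
  (grad_lip : locally_lipschitz (grad f))
  (xs : 'rV[R]_n) (xs_min : minimizers f xs)
  (x : nat -> 'rV[R]_n) (alpha theta : nat -> R)
  (x_adabb : adabb f x alpha theta)
  (smooth : exists2 L : R, 0 < L &
    {in eball xs (adabb_radius f x alpha xs) &, forall u v : 'rV[R]_n,
      f u - f v - dotp (grad f v) (u - v)
        >= 1 / (2 * L) * enorm (grad f u - grad f v) ^+ 2}) :
  (exists2 xbar : 'rV[R]_n, minimizers f xbar & x k @[k --> \oo] --> xbar) /\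
  (fun k : nat => \big[Num.min/enorm (grad f (x 1%N)) ^+ 2]_(1 <= i < k.+1)
                     enorm (grad f (x i)) ^+ 2)
    =O_\oo (fun k : nat => k%:R^-1 : R).
Proof.
case: smooth => L L0 smooth.
have inv k := adabb_invariant f xs x alpha theta L f_convex f_diff xs_min
  x_adabb L0 smooth k.
set alpha_min := Num.min _ _ in inv; set r2 := (_ ^+ 2 + _ + _) in inv.
have a00 : 0 < alpha 0%N by case: x_adabb.
have c0 : 0 < alpha_min by rewrite lt_min a00 !divr_gt0// sqrtr_gt0.
have r20 : 0 <= r2 by case: (inv 0%N) => _ _ _ _ [/(le_trans (dotpp_ge0 _))].
have F0 z k : minimizers f z -> 0 <= f (x k) - f z by move=> zm; rewrite subr_ge0 zm.
have lyap0 z k : minimizers f z -> 0 <= lyapunov f x alpha theta z k.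
  move=> zm; case: (inv k) => ak tk _ _ _; rewrite /lyapunov.
  rewrite !addr_ge0 ?dotpp_ge0// mulr_ge0 ?sqr_ge0 ?dotpp_ge0 ?F0//.
  by rewrite !mulr_ge0 ?addr_ge0// ltW.
set C := r2 / (alpha_min / L).
have cL0 : 0 < alpha_min / L by rewrite divr_gt0.
have sumC k : \sum_(0 <= i < k) enorm (grad f (x i.+1)) ^+ 2 <= C.
  rewrite /C ler_pdivlMr// mulrC mulr_sumr; case: k => [|k].
    by rewrite big_geq.
  case: (inv k.+1) => _ _ _ _ [_ _ /(_ isT)].
  under [X in _ -> X <= _]eq_bigr do rewrite sqr_enorm.
  by apply: le_trans; rewrite lerDr lyap0.
split; last first.
  apply/eqO_exP; exists (C + 1); first by rewrite ltr_wpDl// divr_ge0// ltW.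
  exists 1%N => // k /= k1.
  have k0 : 0 < k%:R :> R by rewrite ltr0n.
  rewrite !ger0_norm ?invr_ge0 ?ler0n//; last first.
    by apply: le_bigmin => [|i _]; exact: sqr_ge0.
  rewrite ler_pdivlMr// mulrC (le_trans (min_le_sum _ _ _))//.
  by rewrite (le_trans (sumC k))// lerDl.
have gx0 : enorm (grad f (x k.+1)) ^+ 2 @[k --> \oo] --> 0.
  by apply: (cvg0_bounded_sum _ C) => // k; exact: sqr_ge0.
have cluster_min : cluster ((fun k => x k.+1) @ \oo) `<=` minimizers f.
  move=> p xp; suff fp : f p = f xs by move=> v; rewrite fp; exact: xs_min.
  apply/eqP; rewrite -subr_eq0 -sqrf_eq0; apply/eqP.
  apply: (cluster_lim (fun k => x k.+1) (fun u => (f u - f xs) ^+ 2) p _ xp).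
    have : {for p, continuous (fun u => f u - f xs)}.
      by apply: (@cvgB R R^o _ (nbhs p)); [exact: differentiable_continuous | exact: cvg_cst].
    by move=> fcont; apply: (@cvgM R _ (nbhs p)).
  apply: (@squeeze_cvgr _ _ _ _ (fun=> 0) (fun k => enorm (grad f (x k.+1)) ^+ 2 * r2)).
  - apply: nearW => k; rewrite sqr_ge0/=.
    have := convex_grad_le f xs (x k.+1) (f_diff _) f_convex.
    rewrite -(opprB (x k.+1)) dotpNr => FG.
    case: (inv k.+1) => _ _ _ _ [Dr _ _].
    apply: (@le_trans _ _ (dotp (grad f (x k.+1)) (x k.+1 - xs) ^+ 2)).
      by have Fk := F0 xs k.+1 xs_min; rewrite ler_pXn2r ?nnegrE//; lra.
    by rewrite (le_trans (dotp_sqr_le _ _))// sqr_enorm ler_wpM2l// dotpp_ge0.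
  - exact: cvg_cst.
  - by rewrite -(mul0r r2); apply: cvgMl.
(* For every minimizer the Lyapunov values are monotone and nonnegative. *)
pose W k := 2 * (alpha k * (1 + theta k)) * (f (x k) - f xs)
  + alpha k ^+ 2 * dotp (grad f (x k)) (grad f (x k)).
have [p p_min xp] : exists2 p, minimizers f p & (fun k => x k.+1) k @[k --> \oo] --> p.
  apply: (fejer_cvg (fun k => x k.+1) W _ xs r2) => // [k|p p_min].
    by case: (inv k) => _ _ _ _ [].
  have -> : (fun k => dotp (x k.+1 - p) (x k.+1 - p) + W k) =
      lyapunov f x alpha theta p.
    apply/funext => k; rewrite /lyapunov /W addrA.
    by have -> : f xs = f p by apply/eqP; rewrite eq_le xs_min p_min.
  apply: nonincreasing_is_cvgn; last by exists 0 => _ [k _ <-]; exact: lyap0.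
  apply/nonincreasing_seqP => k; case: (inv k) => ak tk lk _ _.
  rewrite -[leLHS]addr0 -(mulr0 (2 * alpha k.+1)).
  apply: lyapunov_decr => //; first by rewrite (lt_le_trans _ lk)// divr_gt0.
  have := convex_grad_le f p (x k.+1) (f_diff _) f_convex.
  by rewrite -(opprB (x k.+1)) dotpNr; lra.
exists p => //.
by rewrite -(cvg_shiftS x).
Qed.
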